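(* Let $T>0$, let $\mathbf{y}\in W^{1,1}([0,T];\mathbb{R}^N)$, and let $\mathbf{F}:[0,T]\times\mathbb{R}^N\to\mathbb{R}^N$ be Borel measurable and map bounded sets to bounded sets ($\mathbf{F}$ is neither assumed locally Lipschitz in the second argument nor continuous), such that for some $\mathbf{y}_0\in\mathbb{R}^N$ $$\mathbf{y}(t)=\int_{[0,t]}\mathbf{F}(s,\mathbf{y}(s))\,ds+\mathbf{y}_0\qquad\text{for all }t\in[0,T].$$ Then for every $\epsilon>0$ there exists a network $\boldsymbol{\eta}=\boldsymbol{\eta}(\epsilon):\mathbb{R}\to\mathbb{R}^N$ with an architecture of type (A), with components $\eta_1(\epsilon),\dots,\eta_N(\epsilon)$, satisfying: (i) $\operatorname{ess\,sup}_{t\in[0,T]}|\boldsymbol{\eta}(\epsilon)(t)-\mathbf{y}(t)|_\infty\le\epsilon$; (ii) $\operatorname{EMVar}(\eta_i(\epsilon);[0,T])\le\operatorname{Var}(y_i;[0,T])$ for all $i=1,\dots,N$; (iii) $|\operatorname{EMVar}(\eta_i(\epsilon);[a,b])-\operatorname{Var}(y_i;[a,b])|\le\epsilon$ for all $a,b\in[0,T]$ (with $a\le b$) and all $i=1,\dots,N$; (iv) there exists a constant $C$ independent of $\epsilon$ such that $\sup_{t\in[0,T]}|\mathbf{F}(t,\boldsymbol{\eta}(\epsilon)(t))|_\infty\le C$.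
   Context: $|\cdot|_\infty$ is the maximum norm on $\mathbb{R}^N$, and $\operatorname{Var}(y_i;[a,b])$ is the total variation of the $i$-th component of $\mathbf{y}$ on $[a,b]$. A network with architecture of type (A) (here with input dimension $d=1$ and output dimension $N$), with $L$ hidden layers and nondecreasing activation function $\sigma:\mathbb{R}\to\mathbb{R}$, is a map $\boldsymbol{\eta}(z)=\sum_{j=1}^K\boldsymbol{\eta}^{(j)}(\mathbf{s}_j\odot z)$ with $\mathbf{s}_j\in\{-1,1\}^d$, $\odot$ componentwise multiplication, and $\boldsymbol{\eta}^{(j)}(z)=A_{L+1,j}\hat\sigma(A_{L,j}\hat\sigma(\cdots\hat\sigma(A_{1,j}z+b_{1,j})\cdots)+b_{L,j})+b_{L+1,j}$, where $\hat\sigma$ is $\sigma$ applied componentwise, all matrices $A_{l,j}$ ($l=1,\dots,L+1$) have nonnegative real entries and, together with the real vectors $b_{l,j}$, compatible sizes. The estimated M-variation of the $i$-th component is $\operatorname{EMVar}(\eta_i;U)=\sum_{j=1}^K\big(\sup_{z\in U}\eta^{(j)}_i(\mathbf{s}_j\odot z)-\inf_{z\in U}\eta^{(j)}_i(\mathbf{s}_j\odot z)\big)$. *)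

(* Defs.v *)
From HB Require Import structures.
From mathcomp Require Import all_boot all_order all_algebra.
From mathcomp Require Import all_classical all_reals all_analysis ess_sup_inf.
Import Order.TTheory GRing.Theory Num.Theory.
Import numFieldNormedType.Exports.

Set Implicit Arguments.
Unset Strict Implicit.
Unset Printing Implicit Defensive.

Local Open Scope classical_set_scope.
Local Open Scope ring_scope.

(* [feedforward R L p q]: the weight matrices and bias vectors of a map
   R^p -> R^q with L hidden layers; the widths of the hidden layers are the
   (arbitrary) arguments m of [Hidden]. *)
Inductive feedforward (R : Type) : nat -> nat -> nat -> Type :=
| Output p q of 'M[R]_(q, p) & 'cV[R]_q : feedforward R 0 p q
| Hidden L p m q of 'M[R]_(m, p) & 'cV[R]_m & feedforward R L m q :
    feedforward R L.+1 p q.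

Fixpoint feedforward_eval (R : pzRingType) (sigma : R -> R) L p q
    (f : feedforward R L p q) : 'cV[R]_p -> 'cV[R]_q :=
  match f with
  | Output _ _ A b => fun x => A *m x + b
  | Hidden _ _ _ _ A b g => fun x =>
      feedforward_eval sigma g (map_mx sigma (A *m x + b))
  end.

(* The biases are unconstrained. *)
Fixpoint nneg_weights (R : numDomainType) L p q (f : feedforward R L p q) :
    Prop :=
  match f with
  | Output _ _ A _ => forall i j, 0 <= A i j
  | Hidden _ _ _ _ A _ g => (forall i j, 0 <= A i j) /\ nneg_weights g
  end.

(* Architecture of type (A).  The estimated M-variation below depends on the
   decomposition into branches and not only on the function represented, so a
   network is the data of its branches and sign vectors. *)
Record networkA (R : numDomainType) (L d N : nat) := NetworkA {
  nbranch : nat;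
  branch : 'I_nbranch -> feedforward R L d N;
  signs : 'I_nbranch -> 'cV[R]_d;
  branch_nneg : forall j, nneg_weights (branch j);
  signsP : forall j i, signs j i ord0 = 1 \/ signs j i ord0 = - 1 }.

(* eta^(j)(s_j (.) z) *)
Definition branch_eval (R : numDomainType) (sigma : R -> R) L d N
    (eta : networkA R L d N) (j : 'I_(nbranch eta)) (z : 'cV[R]_d) : 'cV[R]_N :=
  feedforward_eval sigma (branch j) (map2_mx *%R (signs j) z).

Definition network_eval (R : numDomainType) (sigma : R -> R) L d N
    (eta : networkA R L d N) (z : 'cV[R]_d) : 'cV[R]_N :=
  \sum_(j < nbranch eta) branch_eval sigma j z.

Definition EMVar (R : realType) (sigma : R -> R) L d N
    (eta : networkA R L d N) (i : 'I_N) (U : set 'cV[R]_d) : \bar R :=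
  (\sum_(j < nbranch eta)
     (ereal_sup [set (branch_eval sigma j z i ord0)%:E | z in U]
      - ereal_inf [set (branch_eval sigma j z i ord0)%:E | z in U]))%E.

(* R^1 is identified with R through [const_mx]. *)
Definition network_fun (R : numDomainType) (sigma : R -> R) L N
    (eta : networkA R L 1 N) (t : R) : 'cV[R]_N :=
  network_eval sigma eta (const_mx t).

Definition EMVar_itv (R : realType) (sigma : R -> R) L N
    (eta : networkA R L 1 N) (i : 'I_N) (a b : R) : \bar R :=
  EMVar sigma eta i [set const_mx t | t in `[a, b]].

(* C^oo functions on R with compact support contained in ]a, b[ *)
Definition test_function (R : realType) (a b : R) (phi : R -> R) : Prop :=
  (forall n x, derivable (derive1n n phi) x 1) /\
  (exists c d, [/\ a < c, d < b & forall x, phi x != 0 -> c <= x <= d]).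

(* W^{1,1}([a, b]): integrable, with an integrable weak derivative g.
   Integrability is with respect to the Borel sigma-algebra; every class of
   almost everywhere equal functions has Borel representatives. *)
Definition sobolev11 (R : realType) (a b : R) (f : R -> R) : Prop :=
  let mu := @lebesgue_measure R in
  mu.-integrable `[a, b] (EFin \o f) /\
  exists2 g : R -> R, mu.-integrable `[a, b] (EFin \o g) &
    forall phi, test_function a b phi ->
      \int[mu]_(x in `[a, b]) (f x * derive1 phi x) =
      - \int[mu]_(x in `[a, b]) (g x * phi x).

Definition sobolev11_vec (R : realType) (a b : R) N (f : R -> 'cV[R]_N) :
    Prop :=
  forall i : 'I_N, sobolev11 a b (fun t => f t i ord0).

(* For closed D, measurability on D with respect to the trace of the Borel
   sigma-algebra of X is Borel measurability on the subspace D.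
   [normedModType] rather than [ptopologicalType], because products have no
   canonical instance of the latter. *)
Definition borel_measurable_fun (R : realType) (X Y : normedModType R)
    (D : set X) (f : X -> Y) : Prop :=
  measurable_fun (D : set (g_sigma_algebraType (@open X)))
    (f : g_sigma_algebraType (@open X) -> g_sigma_algebraType (@open Y)).

Definition ess_sup_itv (R : realType) (a b : R) (f : R -> R) : \bar R :=
  ess_sup (mrestr (@lebesgue_measure R) (measurable_itv `[a, b]))
    (EFin \o f).

(* Main.v *)
Require Import Defs.
From HB Require Import structures.
From mathcomp Require Import all_boot all_order all_algebra.
From mathcomp Require Import all_classical all_reals all_analysis.
From mathcomp Require Import ess_sup_inf measurable_realfun.
From mathcomp Require Import ring lra.
Import Order.TTheory GRing.Theory Num.Theory.
Import numFieldNormedType.Exports.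
Local Open Scope classical_set_scope.
Local Open Scope ring_scope.
Set Implicit Arguments.
Unset Strict Implicit.
Unset Printing Implicit Defensive.

(** The function y turns out to be Lipschitz, and the network is a staircase
    version of the Jordan decomposition of y.

    Regularity.  A function of W^{1,1}(]a, b[) with weak derivative g is
    essentially bounded: tested against the difference of two smooth steps
    located at c and d, the weak derivative identity bounds the difference of
    the mollified values of f at c and d by the integral of |g|, and at Lebesgue
    points the mollified values converge to those of f
    ([sobolev11_ae_bounded]).  As F maps bounded sets to bounded sets, the
    integrand s |-> F(s, y(s)) is essentially bounded, and the integral
    equation makes y Lipschitz at every point of [0, T]
    ([solution_lipschitz]).

    Decomposition.  With V(t) the variation of y_i on [0, t], the functions
    p = (V + y_i) / 2 and q = (V - y_i) / 2 are nondecreasing and Lipschitz,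
    y_i = p - q, and the variation of y_i on [s, t] is the increment of p plus
    the increment of q ([lipschitz_jordan]).

    Network.  The activation function is the Heaviside function, for which the
    networks with nonnegative weights contain all nondecreasing staircases.
    One branch, fed with t, samples p on a fine grid; the other one, fed with
    - t, samples the nondecreasing function s |-> - q(- s)
    ([step_network_approx]).  The branches being nondecreasing in their inputs,
    the estimated M-variation on [a, b] is the sum of two increments
    ([two_branch_EMVar]).  It is close to the variation of y_i because the
    branches are uniformly close to p and - q, and it does not exceed the
    variation on [0, T] because the staircases take only values between the
    extreme ones of p and - q.  The constant C bounds F on a ball that contains
    the values of y enlarged by 1, which is why the precision is capped at 1. *)

(** * A smooth step function *)

Section smooth.
Context {R : realType}.
Implicit Types f g : R -> R.

Definition smooth f := forall n x, derivable (derive1n n f) x 1.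

(** Stated for n derivatives at a time, smoothness is stable under product and
    composition by induction on n: the derivatives of f * g and g \o f involve
    f and g themselves, of which only n derivatives are needed. *)
Fixpoint nderivable n f : Prop :=
  if n is m.+1 then (forall x, derivable f x 1) /\ nderivable m f^`()%classic
  else True.

Lemma smooth_nderivable f : smooth f <-> forall n, nderivable n f.
Proof.
split=> [sf n|df n].
  elim: n f sf => //= n IH f sf; split; first exact: (sf 0%N).
  by apply: IH => k x; rewrite -derive1Sn; exact: sf.
elim: n f df => [|n IH] f df; first exact: (df 1%N).1.
by rewrite derive1Sn; apply: IH => k; exact: (df k.+1).2.
Qed.

Lemma nderivableW n f : nderivable n.+1 f -> nderivable n f.
Proof. by elim: n f => // n IH f [df /IH]. Qed.

Lemma nderivable_cst n (c : R) : nderivable n (cst c).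
Proof.
elim: n c => //= n IH c; split => //.
rewrite (_ : (cst c)^`()%classic = cst 0) //.
by apply/funext => x; rewrite derive1_cst.
Qed.

Lemma nderivableD n f g :
  nderivable n f -> nderivable n g -> nderivable n (f \+ g).
Proof.
elim: n f g => //= n IH f g [df nf] [dg ng]; split=> [x|].
  exact: derivableD.
suff -> : (f \+ g)^`()%classic = f^`()%classic \+ g^`()%classic by exact: IH.
by apply/funext => x /=; rewrite !derive1E deriveD.
Qed.

Lemma nderivableM n f g :
  nderivable n f -> nderivable n g -> nderivable n (f \* g).
Proof.
elim: n f g => [//|n IH] f g nf ng.
have [nfW ngW] := (nderivableW nf, nderivableW ng).
case: nf ng => df nf [dg ng]; split=> [x|]; first exact: derivableM.
suff -> : (f \* g)^`()%classic = (f \* g^`()%classic) \+ (g \* f^`()%classic).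
  exact: nderivableD (IH _ _ nfW ng) (IH _ _ ngW nf).
by apply/funext => x /=; rewrite !derive1E deriveM.
Qed.

Lemma nderivable_comp n f g :
  nderivable n f -> nderivable n g -> nderivable n (g \o f).
Proof.
elim: n f g => [//|n IH] f g nf ng.
have nfW := nderivableW nf.
case: nf ng => df nf [dg ng]; split=> [x|].
  apply/derivable1_diffP; apply: differentiable_comp; exact/derivable1_diffP.
suff -> : (g \o f)^`()%classic = (g^`()%classic \o f) \* f^`()%classic.
  exact: nderivableM (IH _ _ nfW ng) nf.
by apply/funext => x /=; rewrite derive1_comp.
Qed.

Lemma smooth_affine (a b : R) : smooth (fun x => a * x + b).
Proof.
have da (x : R) : is_derive x (1 : R) (fun x => a * x + b) a.
  by apply: is_derive_eq; rewrite addr0 /GRing.scale/= mulr1.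
apply/smooth_nderivable => -[//|n]; split=> [x|]; first exact: ex_derive.
suff -> : (fun x => a * x + b)^`()%classic = cst a by exact: nderivable_cst.
by apply/funext => x; rewrite derive1E derive_val.
Qed.

Lemma smoothD f g : smooth f -> smooth g -> smooth (f \+ g).
Proof.
move=> /smooth_nderivable sf /smooth_nderivable sg.
by apply/smooth_nderivable => n; exact: nderivableD.
Qed.

Lemma smooth_comp f g : smooth f -> smooth g -> smooth (g \o f).
Proof.
move=> /smooth_nderivable sf /smooth_nderivable sg.
by apply/smooth_nderivable => n; exact: nderivable_comp.
Qed.

(** The functions P(1/x) exp(-1/x), extended by 0 to x <= 0, form a family that
    is stable under derivation; for P = 1 this is the classical flat function. *)
Definition flat (P : {poly R}) (x : R) : R :=
  if 0 < x then P.[x^-1] * expR (- x^-1) else 0.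

Lemma expR_ge_pow (u : R) n : 0 <= u -> u ^+ n / n`!%:R <= expR u.
Proof.
move=> u0; case: n => [|n]; first by rewrite expr0 fact0 divr1 -expR0 ler_expR.
by apply: le_trans (expR_ge1Dxn n u0); rewrite lerDr.
Qed.

Lemma flat_bounded P : exists M, forall x, `|flat P x| <= M.
Proof.
exists (\sum_(i < size P) `|P`_i| * i`!%:R) => x; rewrite /flat.
case: ifPn => x0; last first.
  by rewrite normr0; apply: sumr_ge0 => i _; rewrite mulr_ge0.
rewrite horner_coef mulr_suml; apply: le_trans (ler_norm_sum _ _ _) _.
apply: ler_sum => i _; rewrite -mulrA normrM ler_wpM2l//.
have x1 : 0 <= x^-1 by rewrite invr_ge0 ltW.
rewrite ger0_norm; last by rewrite mulr_ge0 ?exprn_ge0 ?expR_ge0.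
rewrite expRN ler_pdivrMr ?expR_gt0// mulrC -ler_pdivrMr ?ltr0n ?fact_gt0//.
exact: expR_ge_pow.
Qed.

(** At 0 the difference quotient flat P h / h equals h * flat (X^2 P) h, which
    tends to 0 because flat functions are bounded. *)
Lemma is_derive_flat P (x : R) :
  is_derive x 1 (flat P) (flat ('X^2 * (P - P^`()%R)) x).
Proof.
case: (ltgtP x 0) => [x0|x0|->].
- rewrite {2}/flat ltNge (ltW x0)/=.
  apply: (@near_eq_is_derive _ _ _ (cst 0)).
    near=> z; rewrite /flat ltNge ifF//; apply/negbF/ltW.
    by near: z; exact: lt_nbhsl.
- rewrite {2}/flat x0.
  pose F : R -> R := (horner P \o (fun z => z^-1)) * (expR \o (fun z => - z^-1)).
  apply: (@near_eq_is_derive _ _ _ F).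
    near=> z; rewrite /flat ifT//.
    by near: z; exact: lt_nbhsr.
  have dV : is_derive x 1 (fun z : R => z^-1) (- x ^- 2).
    by apply: is_derive_eq; [apply: is_deriveV; rewrite gt_eqF|rewrite scaler1].
  have dP : is_derive x 1 (horner P \o (fun z : R => z^-1))
      (P^`()%R.[x^-1] * (- x ^- 2)).
    exact: is_derive1_comp.
  have dE : is_derive x 1 (expR \o (fun z : R => - z^-1))
      (expR (- x^-1) * x ^- 2).
    apply: is_derive1_comp; rewrite -[x ^- 2]opprK; exact: is_deriveN.
  have D := is_deriveM dP dE. apply: (@is_derive_eq _ _ _ F x 1 _ _ D).
  rewrite hornerM hornerXn hornerD hornerN -exprVn /GRing.scale/=; ring.
- rewrite {2}/flat ltxx.
  have [M PM] := flat_bounded ('X^2 * P).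
  suff H : (fun h : R => h^-1 *: (flat P (h *: 1 + 0) - flat P 0)) @ 0^' --> (0:R).
    apply: DeriveDef; first by apply: cvgP H.
    exact: cvg_lim H.
  apply: norm_cvg0.
  apply: (@squeeze_cvgr _ _ _ _ (cst 0) (fun h : R => M * `|h|)).
  + near=> h; rewrite normr_ge0/=.
    have h0 : h != 0 by near: h; exact: nbhs_dnbhs_neq.
    rewrite /GRing.scale/= mulr1 addr0 [X in _ - X]/flat ltxx subr0.
    have -> : h^-1 * flat P h = h * flat ('X^2 * P) h.
      rewrite /flat; case: ifPn => _; last by rewrite !mulr0.
      by rewrite hornerM hornerXn; field.
    by rewrite normrM mulrC ler_wpM2r.
  + exact: cvg_cst.
  + rewrite -[X in _ --> X](mulr0 M) -[X in _ --> M * X](@normr0 _ R).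
    apply: cvgM; first exact: cvg_cst.
    by apply: cvg_norm; exact: cvg_within.
Unshelve. all: by end_near. Qed.

End smooth.

Section smooth_step.
Context {R : realType}.

Lemma smooth_flat (P : {poly R}) : smooth (flat P).
Proof.
apply/smooth_nderivable => n; elim: n P => //= n IH P; split=> [x|].
  by have [] := is_derive_flat P x.
suff -> : (flat P)^`()%classic = flat ('X^2 * (P - P^`()%R)) by exact: IH.
apply/funext => x; rewrite derive1E.
by have [_ ->] := is_derive_flat P x.
Qed.

Let e : R := expR 1.

(** With E(x) = e exp(-1/x), which vanishes for x <= 0 and is at least 1 for
    x >= 1, the function 1 - E(1 - E(x)) is exactly 0 for x <= 0, since E(1) = 1,
    and exactly 1 for x >= 1. *)
Definition smooth_step (x : R) : R := 1 - e * flat 1 (1 - e * flat 1 x).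

Lemma flat1_ge0 (x : R) : 0 <= flat 1 x.
Proof. by rewrite /flat; case: ifP => // _; rewrite hornerC mul1r expR_ge0. Qed.

Lemma e_flat1_le1 (x : R) : x <= 1 -> e * flat 1 x <= 1.
Proof.
move=> x1; rewrite /flat; case: ifPn => [x0|_]; last by rewrite mulr0.
rewrite hornerC mul1r -expRD -[leRHS]expR0 ler_expR subr_le0.
by rewrite invf_ge1.
Qed.

Lemma e_flat1_ge1 (x : R) : 1 <= x -> 1 <= e * flat 1 x.
Proof.
move=> x1; have x0 : 0 < x by exact: lt_le_trans x1.
rewrite /flat x0 hornerC mul1r -expRD -[leLHS]expR0 ler_expR subr_ge0.
by rewrite invf_le1.
Qed.

Lemma smooth_step_le0 (x : R) : x <= 0 -> smooth_step x = 0.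
Proof.
move=> x0; rewrite /smooth_step {2}/flat ltNge x0/= mulr0 subr0.
by rewrite /flat ltr01 hornerC mul1r invr1 -expRD subrr expR0 subrr.
Qed.

Lemma smooth_step_ge1 (x : R) : 1 <= x -> smooth_step x = 1.
Proof.
move=> x1; rewrite /smooth_step {1}/flat ltNge subr_le0 e_flat1_ge1//=.
by rewrite mulr0 subr0.
Qed.

Lemma smooth_step_itv (x : R) : 0 <= smooth_step x <= 1.
Proof.
have e0 : 0 < e by exact: expR_gt0.
rewrite /smooth_step subr_ge0 e_flat1_le1; last first.
  by rewrite lerBlDl lerDr; apply: mulr_ge0; [exact: ltW|exact: flat1_ge0].
by rewrite lerBlDl lerDr; apply: mulr_ge0; [exact: ltW|exact: flat1_ge0].
Qed.

Lemma smooth_smooth_step : smooth smooth_step.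
Proof.
have sa (f : R -> R) : smooth f -> smooth (fun x => 1 - e * f x).
  move=> sf; have := smooth_comp sf (@smooth_affine R (- e) 1).
  by congr smooth; apply/funext => x /=; rewrite mulNr addrC.
exact: sa (smooth_comp (sa _ (@smooth_flat 1)) (@smooth_flat 1)).
Qed.

End smooth_step.

Section step_derivative.
Context {R : realType}.

Lemma smooth_continuous (f : R -> R) : smooth f -> continuous f^`()%classic.
Proof.
by move=> sf x; apply/differentiable_continuous/derivable1_diffP/(@sf 1%N).
Qed.

Definition step_slope : R -> R := derive1 smooth_step.

Lemma continuous_step_slope : continuous step_slope.
Proof. exact/smooth_continuous/smooth_smooth_step. Qed.

Lemma step_slope_out (x : R) : x < 0 \/ 1 < x -> step_slope x = 0.
Proof.
move=> x01; have [c xc] : exists c : R, \near x, smooth_step x = cst c x.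
  case: x01 => x01.
    exists 0; near=> z; apply: smooth_step_le0; apply: ltW.
    by near: z; exact: lt_nbhsl.
  exists 1; near=> z; apply: smooth_step_ge1; apply: ltW.
  by near: z; exact: lt_nbhsr.
by rewrite /step_slope derive1E (near_eq_derive _ xc) derive_cst.
Unshelve. all: by end_near. Qed.

Lemma continuous_support_bounded (f : R -> R) : continuous f ->
  (forall x, x < 0 \/ 1 < x -> f x = 0) -> exists K : R, forall x, `|f x| <= K.
Proof.
move=> cf f0; have [||c c01 cmax] := @EVT_max R (fun x => `|f x|) 0 1 => //.
  by apply: continuous_subspaceT => x; apply: cvg_norm; exact: cf.
exists `|f c| => x; have [x01|x01] := boolP (x \in `[0, 1]).
  exact: cmax.
rewrite f0 ?normr0//.
by move: x01; rewrite in_itv/= negb_and -!ltNge => /orP.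
Qed.

Lemma step_slope_bounded : exists K : R, forall x, `|step_slope x| <= K.
Proof.
apply: continuous_support_bounded; first exact: continuous_step_slope.
exact: step_slope_out.
Qed.

Lemma smooth_step_scaled (c r : R) : smooth (fun x => smooth_step ((x - c) / r)).
Proof.
have := smooth_comp (@smooth_affine R r^-1 (- c / r)) smooth_smooth_step.
congr smooth; apply/funext => x /=; congr smooth_step.
by rewrite mulrBl mulrC mulNr.
Qed.

Lemma derive1_smooth_step_scaled (c r x : R) :
  derive1 (fun x => smooth_step ((x - c) / r)) x = r^-1 * step_slope ((x - c) / r).
Proof.
pose g (x : R) := r^-1 * x + - c / r.
have dg : is_derive x 1 g r^-1.
  by apply: is_derive_eq; rewrite addr0 /GRing.scale/= mulr1.
have -> : (fun x => smooth_step ((x - c) / r)) = smooth_step \o g.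
  apply/funext => z /=; congr smooth_step.
  by rewrite /g mulrBl mulrC mulNr.
rewrite derive1_comp; [|by case: dg|exact: (@smooth_smooth_step R 0%N _)].
rewrite (derive1E g) derive_val mulrC; congr (_ * step_slope _).
by rewrite /g mulrBl mulrC mulNr.
Qed.

End step_derivative.

(** * Essential boundedness of Sobolev functions *)

Section sobolev_bounded.
Context {R : realType}.
Local Notation mu := (@lebesgue_measure R).

(** The derivative of a smooth step from c to c + r / 2, used as a mollifier:
    it is supported in the ball of centre c and radius r. *)
Definition kernel (c r x : R) : R :=
  (r / 2)^-1 * step_slope ((x - c) / (r / 2)).

Lemma continuous_kernel (c r : R) : continuous (kernel c r).
Proof.
have <- : derive1 (fun x => smooth_step ((x - c) / (r / 2))) = kernel c r.
  by apply/funext => x; rewrite derive1_smooth_step_scaled.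
exact: smooth_continuous (@smooth_step_scaled R c (r / 2)).
Qed.

Lemma measurable_kernel (c r : R) (D : set R) : measurable_fun D (kernel c r).
Proof.
apply: measurable_funTS; apply: continuous_measurable_fun.
exact: continuous_kernel.
Qed.

Lemma kernel_out (c r x : R) : 0 < r -> ~ ball c r x -> kernel c r x = 0.
Proof.
move=> r0; rewrite ball_itv /= in_itv/= => /negP; rewrite negb_and -!leNgt => cx.
have r20 : 0 < r / 2 by rewrite divr_gt0.
rewrite /kernel step_slope_out ?mulr0//; case/orP: cx => cx.
  left; rewrite pmulr_llt0 ?invr_gt0// subr_lt0.
  by apply: le_lt_trans cx _; rewrite ltrBlDr ltrDl.
right; rewrite ltr_pdivlMr// mul1r ltrBrDl.
by apply: lt_le_trans cx; rewrite ltrD2l gtr_pMr// invf_lt1// ltr1n.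
Qed.

Lemma kernel_bounded (K c r x : R) : 0 < r ->
  (forall x : R, `|step_slope x| <= K) -> `|kernel c r x| <= (r / 2)^-1 * K.
Proof.
move=> r0 Kb; have r2 : 0 <= (r / 2)^-1 by rewrite invr_ge0 divr_ge0// ltW.
by rewrite /kernel normrM ger0_norm// ler_wpM2l.
Qed.

Lemma kernel_bounded_itv (c r : R) (D : set R) : 0 < r ->
  [bounded kernel c r x | x in D].
Proof.
move=> r0; have [K Kb] := @step_slope_bounded R.
exists ((r / 2)^-1 * K); split; first exact: num_real.
by move=> M KM x _; apply: le_trans (ltW KM); exact: kernel_bounded.
Qed.

Lemma Rintegral_kernel (a b c r : R) : 0 < r -> a < c - r -> c + r < b ->
  \int[mu]_(x in `[a, b]) kernel c r x = 1.
Proof.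
move=> r0 ac cb; have r20 : 0 < r / 2 by rewrite divr_gt0.
pose F x := smooth_step ((x - c) / (r / 2)).
have ab : a < b by apply: lt_trans (lt_trans ac _) cb; rewrite ltrD2l gtrN.
have sF : smooth F by exact: smooth_step_scaled.
have cF : continuous F.
  by move=> x; apply/differentiable_continuous/derivable1_diffP/(@sF 0%N).
rewrite /Rintegral (@continuous_FTC2 _ _ F)//=.
- rewrite /F smooth_step_ge1 ?smooth_step_le0 ?subr0//.
    by rewrite pmulr_lle0 ?invr_gt0// subr_le0 (le_trans (ltW ac))// gerBl ltW.
  rewrite ler_pdivlMr// mul1r lerBrDl (le_trans _ (ltW cb))// lerD2l.
  by rewrite ler_pdivrMr// ler_peMr ?ler1n// ltW.
- apply: continuous_subspaceT => x; exact: continuous_kernel.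
- split=> [x _||]; first exact: (@sF 0%N).
    by apply: cvg_at_right_filter; exact: cF.
  by apply: cvg_at_left_filter; exact: cF.
- by move=> x _; rewrite derive1_smooth_step_scaled.
Qed.

(** The two steps are opposite, so the sum vanishes to the left of both of them
    and to the right of both of them. *)
Lemma test_function_steps (a b c d r : R) : 0 < r ->
  a < c - r -> c + r < b -> a < d - r -> d + r < b ->
  test_function a b
    ((fun x => smooth_step ((x - c) / (r / 2))) \+
     (fun x => (-1) * smooth_step ((x - d) / (r / 2)) + 0)).
Proof.
move=> r0 ac cb ad db; have r20 : 0 < r / 2 by rewrite divr_gt0.
split.
  apply: smoothD; first exact: smooth_step_scaled.
  exact: (smooth_comp (@smooth_step_scaled R d (r / 2)) (@smooth_affine R (-1) 0)).
exists (Num.min c d - r), (Num.max c d + r); split.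
- by rewrite ltrBrDr lt_min -!ltrBrDr ac.
- by rewrite -ltrBrDr gt_max !ltrBrDr cb.
move=> x; apply: contra_neqT; rewrite negb_and -!ltNge => /orP[xcd|cdx] /=.
  have [xc xd] : x < c /\ x < d.
    have : x < Num.min c d by apply: lt_trans xcd _; rewrite ltrBlDr ltrDl.
    by rewrite lt_min => /andP.
  rewrite !smooth_step_le0 ?mulr0 ?addr0// pmulr_lle0 ?invr_gt0// subr_le0 ltW//.
have [cx dx] : c + r < x /\ d + r < x.
  by move: cdx; rewrite -ltrBrDr gt_max !ltrBrDr => /andP.
have r2 : r / 2 <= r by rewrite ler_pdivrMr// ler_peMr ?ler1n// ltW.
rewrite !smooth_step_ge1; first by rewrite mulr1 addr0 subrr.
  by rewrite ler_pdivlMr// mul1r lerBrDl (le_trans _ (ltW dx))// lerD2l.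
by rewrite ler_pdivlMr// mul1r lerBrDl (le_trans _ (ltW cx))// lerD2l.
Qed.

End sobolev_bounded.

Section sobolev_bounded_mollification.
Context {R : realType}.
Local Notation mu := (@lebesgue_measure R).

Lemma integrable_mul_kernel (f : R -> R) (D : set (measurableTypeR R)) (c r : R) :
  measurable D -> 0 < r -> mu.-integrable D (EFin \o f) ->
  mu.-integrable D (EFin \o (fun x => f x * kernel c r x)).
Proof.
move=> mD r0 intf.
have := integrableMl mD intf (@measurable_kernel R c r D)
  (@kernel_bounded_itv R c r D r0).
by apply: eq_integrable.
Qed.

(** The derivative of the test function of [test_function_steps] is the
    difference of the kernels at c and d, and the test function is bounded by 1:
    the weak derivative identity bounds the difference of the two mollified
    values by the integral of |g|, uniformly in r. *)
Lemma mollification_dist_le (a b : R) (f : R -> R) : a < b -> sobolev11 a b f ->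
  exists M, forall c d r, 0 < r ->
    a < c - r -> c + r < b -> a < d - r -> d + r < b ->
    `|\int[mu]_(x in `[a, b]) (f x * kernel c r x)
      - \int[mu]_(x in `[a, b]) (f x * kernel d r x)| <= M.
Proof.
move=> ab [intf [g intg fg]].
exists (\int[mu]_(x in `[a, b]) `|g x|) => c d r r0 ac cb ad db.
pose phi x := smooth_step ((x - c) / (r / 2))
  + ((-1) * smooth_step ((x - d) / (r / 2)) + 0).
have tphi : test_function a b phi by exact: test_function_steps.
have sphi : continuous phi.
  by move=> x; apply/differentiable_continuous/derivable1_diffP/(tphi.1 0%N).
have dphi x : derive1 phi x = kernel c r x - kernel d r x.
  have dS e : is_derive x 1 (fun x : R => smooth_step ((x - e) / (r / 2)))
      (kernel e r x).
    apply: DeriveDef; first exact: (@smooth_step_scaled R e (r / 2) 0%N).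
    by rewrite -derive1E derive1_smooth_step_scaled.
  have D := is_deriveD (dS c)
    (is_deriveD (is_deriveZ (-1) (dS d)) (is_derive_cst 0 x 1)).
  have [_ Dphi] : is_derive x 1 phi
    (kernel c r x + ((-1) *: kernel d r x + 0)) := D.
  by rewrite derive1E Dphi addr0 scaleN1r.
have phi1 x : `|phi x| <= 1.
  rewrite /phi mulN1r addr0.
  have := smooth_step_itv ((x - c) / (r / 2)).
  have := smooth_step_itv ((x - d) / (r / 2)).
  move: (smooth_step _) (smooth_step _) => u v /andP[? ?] /andP[? ?].
  by rewrite ler_norml; lra.
have mab : measurable (`[a, b] : set (measurableTypeR R)) by [].
rewrite -RintegralB//; [|exact: integrable_mul_kernel..].
under eq_Rintegral do rewrite -mulrBr -dphi.
rewrite fg// normrN.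
have intgphi : mu.-integrable `[a, b] (EFin \o (fun x => g x * phi x)).
  have bphi : [bounded phi x | x in `[a, b]].
    by exists 1; split; [exact: num_real|move=> N N1 x _; exact: le_trans (ltW N1)].
  have mphi : measurable_fun `[a, b] phi.
    by apply: measurable_funTS; exact: continuous_measurable_fun.
  by have := integrableMl mab intg mphi bphi; apply: eq_integrable.
apply: le_trans (le_normr_Rintegral _ intgphi) _ => //.
apply: le_Rintegral => //.
- exact: (integrable_norm intgphi).
- exact: (integrable_norm intg).
- by move=> x _; rewrite normrM ler_piMr.
Qed.

(** The kernel has integral 1 and is bounded by a multiple of 1 / r on the ball
    of radius r, so that the error is at most a multiple of the average of
    |f - f(c)| on this ball. *)
Lemma mollification_cvg (a b c : R) (f : R -> R) :
  mu.-integrable `[a, b] (EFin \o f) -> a < c < b ->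
  lebesgue_pt (f \_ `[a, b]) c -> forall e : R, 0 < e -> \forall r \near 0^'+,
    `|\int[mu]_(x in `[a, b]) (f x * kernel c r x) - f c| <= e.
Proof.
move=> intf /andP[ac cb] fc e e0.
have [K Kb] := @step_slope_bounded R.
have K0 : 0 <= K by exact: le_trans (Kb 0).
(* The error will be at most 4 K times the average; adding 1 keeps the
   denominator positive. *)
pose e' := e / (4 * K + 1).
have e'0 : 0 < e' by rewrite divr_gt0// ltr_wpDl// mulr_ge0.
have /fine_cvgP[davgfin /cvgrPdist_lt /(_ _ e'0) davge] := fc.
near=> r.
have r0 : 0 < r by near: r; exact: nbhs_right_gt.
have acr : a < c - r.
  by rewrite ltrBrDr addrC -ltrBrDr; near: r; apply: nbhs_right_lt; rewrite subr_gt0.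
have crb : c + r < b.
  by rewrite addrC -ltrBrDr; near: r; apply: nbhs_right_lt; rewrite subr_gt0.
have davgfin_r : davg (f \_ `[a, b]) c r \is a fin_num by near: r.
have davg_r : fine (davg (f \_ `[a, b]) c r) <= e'.
  have : `|0 - fine (davg (f \_ `[a, b]) c r)| < e' by near: r.
  by rewrite sub0r normrN => /ltW; exact/le_trans/ler_norm.
have mab : measurable (`[a, b] : set (measurableTypeR R)) by [].
have fcE : (f \_ `[a, b]) c = f c by rewrite patchE mem_set//= in_itv/= !ltW.
have intk : mu.-integrable `[a, b] (EFin \o kernel c r).
  apply: measurable_bounded_integrable => //; last exact: kernel_bounded_itv.
    by rewrite /= lebesgue_measure_itv/=; case: ifP; rewrite ?ltry.
  exact: measurable_kernel.
have intfk := integrable_mul_kernel c mab r0 intf.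
have intd : mu.-integrable `[a, b]
    (EFin \o (fun x => f x * kernel c r x - f c * kernel c r x)).
  have := integrableB mab intfk (integrableZl mab (f c) intk).
  by apply: eq_integrable.
have -> : \int[mu]_(x in `[a, b]) (f x * kernel c r x) - f c =
    \int[mu]_(x in `[a, b]) (f x * kernel c r x - f c * kernel c r x).
  rewrite RintegralB//; last by exact: (integrableZl mab (f c) intk).
  by rewrite RintegralZl// Rintegral_kernel// mulr1.
rewrite -lee_fin EFin_normr_Rintegral//.
apply: le_trans (le_abse_integral _ _ _) _ => //.
  by case/integrableP: intd.
pose k := (r / 2)^-1 * K.
have k0 : 0 <= k by rewrite mulr_ge0// invr_ge0 divr_ge0// ltW.
have mf : measurable_fun setT (f \_ `[a, b]).
  apply/(measurable_restrictT _ _).1 => //.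
  by apply/measurable_EFinP; case/integrableP: intf.
have mh : measurable_fun setT (fun x => (k * `|(f \_ `[a, b]) x - f c|)%:E).
  apply/measurable_EFinP; apply: measurable_funM => //.
  by apply: measurableT_comp => //; exact: measurable_funB.
apply: (@le_trans _ _ (\int[mu]_(x in ball c r)
    (k%:E * `|((f \_ `[a, b]) x - f c)%:E|))%E); last first.
  rewrite ge0_integralZl//; last 2 first.
  - exact: measurable_ball.
  - apply/measurable_funTS; apply/measurable_EFinP.
    by apply: measurableT_comp => //; exact: measurable_funB.
  have mu_r : mu (ball c r) = (r *+ 2)%:E by rewrite lebesgue_measure_ball// ltW.
  have r20 : r *+ 2 != 0 by rewrite mulrn_eq0/= gt_eqF.
  have -> : (\int[mu]_(x in ball c r) `|((f \_ `[a, b]) x - f c)%:E| =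
      (r *+ 2)%:E * davg (f \_ `[a, b]) c r)%E.
    rewrite /davg /iavg mu_r inver (negbTE r20) muleA -EFinM mulfV// mul1e.
    by apply: eq_integral => x _ /=; rewrite fcE.
  rewrite -(fineK davgfin_r) -!EFinM lee_fin mulrA.
  have -> : k * (r *+ 2) = 4 * K.
    by rewrite /k -mulr_natr; field; rewrite gt_eqF.
  apply: (@le_trans _ _ (4 * K * e')); first by rewrite ler_wpM2l// mulr_ge0.
  have K1 : 4 * K / (4 * K + 1) <= 1.
    by rewrite ler_pdivrMr ?mul1r ?lerDl// ltr_wpDl// mulr_ge0.
  by rewrite /e' mulrCA ler_piMr// ltW.
apply: (@le_trans _ _ (\int[mu]_(x in `[a, b] `&` ball c r)
    (k%:E * `|((f \_ `[a, b]) x - f c)%:E|))%E); last first.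
  apply: ge0_subset_integral => //.
  - by apply: measurableI => //; exact: measurable_ball.
  - exact: measurable_ball.
  - exact: measurable_funTS.
  - by move=> x _; rewrite mule_ge0.
rewrite integral_mkcondr; apply: ge0_le_integral => //.
- by apply: measurableT_comp => //; case/integrableP: intd.
- apply: measurable_funTS; apply/(measurable_restrictT _ _).1.
    exact: measurable_ball.
  exact: measurable_funTS.
move=> x xab; rewrite -mulrBl patchE.
rewrite [leLHS](_ : _ = (`|f x - f c| * `|kernel c r x|)%:E);
  last by rewrite /= normrM.
have fxE : (f \_ `[a, b]) x = f x by rewrite patchE mem_set.
have [xc|xc] := pselect (ball c r x).
  by rewrite mem_set// fxE -EFinM lee_fin mulrC ler_wpM2r// kernel_bounded.
by rewrite kernel_out// normr0 mulr0; case: ifP => // _; rewrite fxE mule_ge0.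
Unshelve. all: by end_near. Qed.

Lemma distr_le_approx (u v p q M e : R) : `|u - p| <= e / 2 ->
  `|v - q| <= e / 2 -> `|u - v| <= M -> `|p - q| <= M + e.
Proof.
by rewrite !ler_norml => /andP[? ?] /andP[? ?] /andP[? ?]; apply/andP; lra.
Qed.

(** The oscillation of f over its Lebesgue points is bounded by the integral of
    |g|, and almost every point is a Lebesgue point. *)
Lemma sobolev11_ae_bounded (a b : R) (f : R -> R) : a < b -> sobolev11 a b f ->
  exists M, {ae mu, forall x, x \in `]a, b[ -> `|f x| <= M}.
Proof.
move=> ab sf; have [intf _] := sf.
have lf : {ae mu, forall x, lebesgue_pt (f \_ `[a, b]) x}.
  apply: lebesgue_differentiation; apply: open_integrable_locally.
    exact: openT.
  have := (@integrable_mkcond _ _ _ mu _ (EFin \o f) (measurable_itv `[a, b])).1 intf.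
  by apply: eq_integrable => // x _; rewrite /= /patch; case: ifP.
have [M Mf] := mollification_dist_le ab sf.
have dist c d : a < c < b -> a < d < b ->
    lebesgue_pt (f \_ `[a, b]) c -> lebesgue_pt (f \_ `[a, b]) d ->
    `|f c - f d| <= M.
  move=> /[dup] acb /andP[ac cb] /[dup] adb /andP[ad db] fc fd.
  apply/ler_addgt0Pr => e e0; have e20 : 0 < e / 2 by rewrite divr_gt0.
  have near_lt (u v : R) : u < v -> \forall r \near 0^'+, u + r < v.
    move=> uv; near=> s; rewrite addrC -ltrBrDr.
    by near: s; apply: nbhs_right_lt; rewrite subr_gt0.
  near (0 : R)^'+ => r.
  have r0 : 0 < r by near: r; exact: nbhs_right_gt.
  apply: (@distr_le_approx (\int[mu]_(x in `[a, b]) (f x * kernel c r x))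
    (\int[mu]_(x in `[a, b]) (f x * kernel d r x))).
  - by near: r; exact: mollification_cvg.
  - by near: r; exact: mollification_cvg.
  - apply: (Mf c d r r0); rewrite ?ltrBrDr; by near: r; exact: near_lt.
have [[c [acb fc]]|nc] :=
  pselect (exists c, a < c < b /\ lebesgue_pt (f \_ `[a, b]) c).
  exists (`|f c| + M).
  apply: (@filterS _ _ (ae_filter_ringOfSetsType mu)) lf => x fx.
  rewrite in_itv/= => axb.
  by rewrite -(subrK (f c) (f x)) addrC (le_trans (ler_normD _ _))// lerD2l dist.
exists 0; apply: (@filterS _ _ (ae_filter_ringOfSetsType mu)) lf => x fx.
rewrite in_itv/= => axb.
by exfalso; apply: nc; exists x.
Unshelve. all: by end_near. Qed.

End sobolev_bounded_mollification.

(** * Indefinite integrals of bounded functions *)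

Section lower_integral.
Context d (T : measurableType d) (R : realType).
Variable mu : {measure set T -> \bar R}.
Import HBNNSimple.
Local Open Scope ereal_scope.

Lemma ge0_integral_sup (D : set T) (f : T -> \bar R) : (forall x, 0 <= f x) ->
  \int[mu]_(x in D) f x = ereal_sup [set sintegral mu h |
    h in [set h : {nnsfun T >-> R} | forall x, (h x)%:E <= (f \_ D) x]].
Proof.
move=> f0; rewrite integral_mkcond ge0_integralTE// => x.
by apply: erestrict_ge0 => ? _.
Qed.

(** For an arbitrary f >= 0 the integral is the supremum of the integrals of the
    simple functions h below f.  The integral of such an h over A is at most
    that of f, and over the rest of B it is at most K times the measure. *)
Lemma ge0_integral_setD_le (A B : set T) (f : T -> \bar R) (K : R) :
  measurable A -> measurable B -> A `<=` B -> (forall x, 0 <= f x) ->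
  (0 <= K)%R -> {ae mu, forall x, B x -> f x <= K%:E} ->
  \int[mu]_(x in A) f x <= \int[mu]_(x in B) f x <=
    \int[mu]_(x in A) f x + K%:E * mu (B `\` A).
Proof.
move=> mA mB AB f0 K0 fK; apply/andP; split.
  rewrite !ge0_integral_sup//; apply: le_ereal_sup => _ [h hA <-].
  exists h => // x; apply: le_trans (hA x) _; rewrite /patch.
  have [xA|_] := boolP (x \in A); last by case: ifP.
  by rewrite mem_set//; apply: AB; exact: set_mem.
rewrite [leLHS]ge0_integral_sup//; apply: ge_ereal_sup => _ [h hB <-].
have mh : measurable_fun setT (EFin \o h) by apply/measurable_EFinP.
rewrite -integralT_nnsfun -(setUv A) ge0_integral_setU//; last 4 first.
- exact: measurableC.
- exact: measurable_funTS.
- by move=> x _; rewrite lee_fin.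
- by apply/disj_setPS => x [].
apply: leeD.
  rewrite (@integral_nnsfun _ _ _ mu _ mA) mrestrict ge0_integral_sup//.
  apply: ereal_sup_ubound; exists (proj_nnsfun h mA) => // x.
  rewrite -mrestrict /patch; case: ifPn => // xA.
  apply: le_trans (hB x) _; rewrite /patch mem_set//.
  by apply: AB; exact: set_mem.
have -> : K%:E * mu (B `\` A) = \int[mu]_(x in ~` A) ((cst K%:E) \_ B) x.
  rewrite -integral_mkcondr setIC -setDE integral_cst//; exact: measurableD.
apply: ae_ge0_le_integral => //.
- exact: measurableC.
- by move=> x _; rewrite lee_fin.
- exact: measurable_funTS.
- by move=> x _; apply: erestrict_ge0 => ? _; rewrite lee_fin.
- by apply: measurable_funTS; apply/(measurable_restrictT _ _).1.
apply: filterS fK => x fxK _; apply: le_trans (hB x) _; rewrite /patch.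
by case: ifP => // /set_mem /fxK.
Qed.

(** The positive and the negative part contribute increments that both lie
    between 0 and the bound, and so does the absolute value of their
    difference. *)
Lemma Rintegral_setD_le (A B : set T) (f : T -> R) (K : R) :
  measurable A -> measurable B -> A `<=` B -> mu B < +oo -> (0 <= K)%R ->
  {ae mu, forall x, B x -> (`|f x| <= K)%R} ->
  (`|\int[mu]_(x in B) f x - \int[mu]_(x in A) f x|
     <= K * fine (mu (B `\` A)))%R.
Proof.
move=> mA mB AB muB K0 fK.
pose g1 := (EFin \o f)^\+; pose g2 := (EFin \o f)^\-.
have g1K : {ae mu, forall x, B x -> g1 x <= K%:E}.
  apply: filterS fK => x fxK /fxK; rewrite ler_norml => /andP[_ fK].
  by rewrite /g1 funeposE ge_max !lee_fin fK.
have g2K : {ae mu, forall x, B x -> g2 x <= K%:E}.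
  apply: filterS fK => x fxK /fxK; rewrite ler_norml => /andP[fK _].
  by rewrite /g2 funenegE ge_max !lee_fin lerNl fK.
have fin (g : T -> \bar R) C : measurable C -> C `<=` B -> (forall x, 0 <= g x) ->
    {ae mu, forall x, B x -> g x <= K%:E} -> \int[mu]_(x in C) g x \is a fin_num.
  move=> mC CB g0 gK; rewrite ge0_fin_numE ?integral_ge0//.
  have /andP[+ _] := ge0_integral_setD_le mC mB CB g0 K0 gK.
  move=> /le_lt_trans; apply.
  have /andP[_] := ge0_integral_setD_le measurable0 mB (@sub0set _ _) g0 K0 gK.
  move=> /le_lt_trans; apply; rewrite integral_set0 add0e setD0.
  by rewrite -(@fineK _ (mu B)) ?ge0_fin_numE// -EFinM ltry.
have muBA : mu (B `\` A) \is a fin_num.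
  rewrite ge0_fin_numE//; apply: le_lt_trans muB.
  by apply: le_measure; rewrite ?inE//; exact: measurableD.
have lip (g : T -> \bar R) : (forall x, 0 <= g x) ->
    {ae mu, forall x, B x -> g x <= K%:E} ->
    (fine (\int[mu]_(x in A) g x) <= fine (\int[mu]_(x in B) g x) <=
      fine (\int[mu]_(x in A) g x) + K * fine (mu (B `\` A)))%R.
  move=> g0 gK; have := ge0_integral_setD_le mA mB AB g0 K0 gK.
  rewrite -(fineK (fin g A mA AB g0 gK)) -(fineK (fin g B mB _ g0 gK))//.
  by rewrite -(fineK muBA) -EFinM -EFinD !lee_fin.
have g10 x : 0 <= g1 x by exact: funepos_ge0.
have g20 x : 0 <= g2 x by exact: funeneg_ge0.
have /andP[p1 p2] := lip g1 g10 g1K; have /andP[q1 q2] := lip g2 g20 g2K.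
have RE (C : set T) : measurable C -> C `<=` B -> (\int[mu]_(x in C) f x =
    fine (\int[mu]_(x in C) g1 x) - fine (\int[mu]_(x in C) g2 x))%R.
  by move=> mC CB; rewrite /Rintegral integralE fineB//; exact: fin.
rewrite !RE//; move: p1 p2 q1 q2.
move: (fine _) (fine _) (fine _) (fine _) (fine _) => ? ? ? ? ? ? ? ? ?.
by rewrite ler_norml; apply/andP; lra.
Qed.

End lower_integral.

(** * Jordan decomposition of Lipschitz functions *)

Section lipschitz_variation.
Context {R : realType}.
Implicit Types (f : R -> R) (a b K : R).

Definition lipschitz_itv K a b f :=
  forall s t, a <= s -> s <= t -> t <= b -> `|f t - f s| <= K * (t - s).

Lemma lipschitz_itvS K a b c d f : a <= c -> d <= b ->
  lipschitz_itv K a b f -> lipschitz_itv K c d f.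
Proof.
by move=> ac db lf s t cs st td; apply: lf st _;
  [exact: le_trans cs|exact: le_trans db].
Qed.

(** f is the difference of the nondecreasing functions (K x + f) / 2 and
    (K x - f) / 2, whose increments add up to K (b - a). *)
Lemma lipschitz_total_variation K a b f : a <= b -> lipschitz_itv K a b f ->
  (total_variation a b f <= (K * (b - a))%:E)%E.
Proof.
move=> ab lf; pose g x := (K * x + f x) / 2; pose h x := (K * x - f x) / 2.
have mono (u : R -> R) : (forall s t, a <= s -> s <= t -> t <= b -> u s <= u t) ->
    {in `[a, b] &, nondecreasing_fun u}.
  by move=> ndu s t; rewrite !in_itv/= => /andP[? _] /andP[_ ?] ?; exact: ndu.
have ndg : {in `[a, b] &, nondecreasing_fun g}.
  apply: mono => s t as' st tb; have := lf s t as' st tb.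
  by rewrite ler_norml /g => /andP[? ?]; lra.
have ndh : {in `[a, b] &, nondecreasing_fun h}.
  apply: mono => s t as' st tb; have := lf s t as' st tb.
  by rewrite ler_norml /h => /andP[? ?]; lra.
have -> : f = g \+ (\- h) by apply/funext => x; rewrite /g /h /=; field.
apply: le_trans (total_variation_le _ _ ab) _.
rewrite total_variationN !nondecreasing_total_variation// -EFinD lee_fin.
by rewrite le_eqVlt; apply/orP; left; apply/eqP; rewrite /g /h; field.
Qed.

Definition increments_le K a b f :=
  forall s t, a <= s -> s <= t -> t <= b -> 0 <= f t - f s <= K * (t - s).

(** Half the sum and half the difference of f and of its variation function V:
    |f(t) - f(s)| is at most V(t) - V(s), so both are nondecreasing and increase
    by at most V(t) - V(s), hence at most K (t - s). *)
Lemma lipschitz_jordan K a b f : a <= b -> lipschitz_itv K a b f ->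
  exists p q, [/\ f = p \- q, increments_le K a b p, increments_le K a b q &
    forall s t, a <= s -> s <= t -> t <= b ->
      total_variation s t f = (p t - p s + (q t - q s))%:E].
Proof.
move=> ab lf; pose V t := fine (total_variation a t f).
have TVV s t : a <= s -> s <= t -> t <= b -> total_variation s t f = (V t - V s)%:E.
  move=> as' st tb; have tv_fin c d : a <= c -> c <= d -> d <= b ->
      total_variation c d f \is a fin_num.
    move=> ac cd db; rewrite ge0_fin_numE ?total_variation_ge0//.
    apply: le_lt_trans (lipschitz_total_variation cd _) (ltry _).
    exact: lipschitz_itvS lf.
  rewrite /V (total_variationD f as' st) fineD ?tv_fin// ?(le_trans st)//.
  by rewrite addrC addKr fineK// tv_fin.
have Vlip s t : a <= s -> s <= t -> t <= b ->
    `|f t - f s| <= V t - V s <= K * (t - s).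
  move=> as' st tb; rewrite -!lee_fin -TVV// total_variation_ge//=.
  by apply: lipschitz_total_variation => //; exact: lipschitz_itvS lf.
exists (fun x => (V x + f x) / 2), (fun x => (V x - f x) / 2); split.
- by apply/funext => x /=; field.
- move=> s t as' st tb; have /andP[] := Vlip s t as' st tb.
  by rewrite ler_norml => /andP[? ?] ?; apply/andP; lra.
- move=> s t as' st tb; have /andP[] := Vlip s t as' st tb.
  by rewrite ler_norml => /andP[? ?] ?; apply/andP; lra.
- by move=> s t as' st tb; rewrite TVV//; congr EFin; field.
Qed.

End lipschitz_variation.

(** * Networks computing staircases *)

Section step_networks.
Context {R : realType}.

Lemma ler_indicator (p q : bool) : (p -> q) -> p%:R <= q%:R :> R.
Proof. by case: p; case: q => // /(_ isT). Qed.

Definition heaviside (u : R) : R := (0 < u)%R%:R.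

Lemma heaviside_homo : {homo heaviside : u v / u <= v}.
Proof.
by move=> u v uv; apply: ler_indicator => u0; exact: lt_le_trans uv.
Qed.

(** The Heaviside function fixes 0 and 1, so hidden layers with identity weights
    and zero biases transmit a vector of zeros and ones unchanged; this provides
    networks of any prescribed depth. *)
Fixpoint relay L m N (W : 'M[R]_(N, m)) (b : 'cV[R]_N) : feedforward R L m N :=
  if L is L'.+1 then Hidden 1%:M 0 (relay L' W b) else Output W b.

Lemma relay_nneg L m N (W : 'M[R]_(N, m)) (b : 'cV[R]_N) :
  (forall i j, 0 <= W i j) -> nneg_weights (relay L W b).
Proof.
move=> W0; elim: L => //= L IH; split => // i j.
by rewrite mxE; case: eqP.
Qed.

Lemma relay_eval L m N (W : 'M[R]_(N, m)) (b : 'cV[R]_N) (x : 'cV[R]_m) :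
  map_mx heaviside x = x ->
  feedforward_eval heaviside (relay L W b) x = W *m x + b.
Proof. by move=> xE; elim: L => //= L IH; rewrite mul1mx addr0 xE. Qed.

(** The first hidden layer computes the indicators of c_k < t; the output layer
    combines them. *)
Lemma step_network L m N (c : 'I_m -> R) (W : 'M[R]_(N, m)) (b : 'cV[R]_N) :
  (0 < L)%N -> (forall i k, 0 <= W i k) ->
  exists2 f : feedforward R L 1 N, nneg_weights f &
    forall t i, feedforward_eval heaviside f (const_mx t) i ord0 =
      \sum_(k < m) W i k * (c k < t)%R%:R + b i ord0.
Proof.
case: L => // L _ W0; pose bias : 'cV[R]_m := \col_k - c k.
exists (Hidden (const_mx 1) bias (relay L W b)).
  by split; [move=> i j; rewrite mxE|exact: relay_nneg].
move=> t i /=; set x := map_mx _ _.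
have xE k : x k ord0 = (c k < t)%R%:R.
  by rewrite !mxE big_ord1 !mxE mul1r /heaviside subr_gt0.
rewrite relay_eval.
  rewrite mxE; congr (_ + _); rewrite mxE.
  by apply: eq_bigr => k _; rewrite xE.
apply/matrixP => k j; rewrite [j]ord1 mxE -[x k 0]/(x k ord0) xE /heaviside.
by case: (c k < t); rewrite ?ltr01 ?ltxx.
Qed.

(** The grid points below t are the first ones, so the sum telescopes up to the
    last of them, x_j. *)
Lemma stair_sum (x u : nat -> R) (t : R) n :
  {homo x : i j / (i <= j)%N >-> i <= j} -> x 0%N <= t ->
  exists2 j, (j <= n)%N /\
      \sum_(k < n) (u k.+1 - u k) * (x k.+1 < t)%R%:R = u j - u 0%N &
    x j <= t /\ (j = n \/ t <= x j.+1).
Proof.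
move=> ndx x0t; elim: n => [|n [j [jn Sj] [xjt]]].
  by exists 0%N; [rewrite big_ord0 subrr|split=> //; left].
rewrite big_ord_recr/= Sj => -[jE|txj].
  have [xnt|txn] := ltP (x n.+1) t.
    exists n.+1; last by split; [exact: ltW|left].
    by split=> //; rewrite jE mulr1; ring.
  exists j; last by split=> //; right; rewrite jE.
  by split; [exact: leq_trans jn _|rewrite mulr0 addr0].
exists j; last by split=> //; right.
split; first exact: leq_trans jn _.
by rewrite ltNge (le_trans txj) ?ndx// mulr0 addr0.
Qed.

(** On a regular grid with m steps, the staircase takes at t the value of g at
    the last grid point x_j below t: hence the two-sided bound by g(a) and g(b),
    and an error of at most K (b - a) / m. *)
Lemma step_network_approx L N (g : 'I_N -> R -> R) (a b K e : R) : (0 < L)%N ->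
  a < b -> 0 <= K -> 0 < e -> (forall i, increments_le K a b (g i)) ->
  exists2 f : feedforward R L 1 N, nneg_weights f &
    exists2 h : 'I_N -> R -> R,
      forall t i, feedforward_eval heaviside f (const_mx t) i ord0 = h i t &
      (forall i, {homo h i : s t / s <= t}) /\
      (forall i t, a <= t <= b -> g i a <= h i t <= g i b /\ `|h i t - g i t| <= e).
Proof.
move=> L0 ab K0 e0 gK.
pose m := (Num.bound (K * (b - a) / e)).+1.
pose step := (b - a) / m%:R.
have m0 : 0 < m%:R :> R by rewrite ltr0n.
have step0 : 0 <= step by rewrite divr_ge0// subr_ge0 ltW.
have Kstep : K * step <= e.
  rewrite /step mulrA ler_pdivrMr// [e * _]mulrC -ler_pdivrMr// ltW//.
  have Kba : 0 <= K * (b - a) / e.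
    by rewrite !mulr_ge0// ?invr_ge0 ?subr_ge0 ltW.
  by apply: lt_trans (archi_boundP Kba) _; rewrite ltr_nat.
pose x (k : nat) : R := a + k%:R * step.
have ndx : {homo x : i j / (i <= j)%N >-> i <= j}.
  by move=> i j ij; rewrite lerD2l ler_wpM2r// ler_nat.
have x0 : x 0%N = a by rewrite /x mul0r addr0.
have xm : x m = b by rewrite /x /step mulrC divfK ?gt_eqF// addrC subrK.
have xS k : x k.+1 = x k + step by rewrite /x -natr1 mulrDl mul1r addrA.
pose W : 'M[R]_(N, m) := \matrix_(i, k) (g i (x k.+1) - g i (x k)).
have W0 i k : 0 <= W i k.
  rewrite mxE; have [] // := andP (gK i (x k) (x k.+1) _ _ _).
  - by rewrite -x0 ndx.
  - by rewrite ndx.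
  - by rewrite -xm ndx.
have [f f0 fE] := step_network (fun k : 'I_m => x k.+1) (\col_i g i a) L0 W0.
pose h (i : 'I_N) (t : R) : R := \sum_(k < m) W i k * (x k.+1 < t)%R%:R + g i a.
exists f => //; exists h; first by move=> t i; rewrite fE !mxE.
split=> [i s t st|i t /andP[at' tb]].
  rewrite lerD2r; apply: ler_sum => k _; rewrite ler_wpM2l//.
  by apply: ler_indicator => /lt_le_trans; apply.
have x0t : x 0%N <= t by rewrite x0.
have [j [jm hj] [xjt tj]] := stair_sum (fun k => g i (x k)) m ndx x0t.
have hE : h i t = g i (x j).
  rewrite /h -[RHS](subrK (g i a)); congr (_ + _).
  move: hj; rewrite /= x0 => <-.
  by apply: eq_bigr => k _; rewrite mxE.
have axj : a <= x j by rewrite -x0 ndx.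
have tstep : t - x j <= step.
  case: tj => [jE|]; last by rewrite xS lerBlDl.
  by rewrite jE xm (le_trans _ step0)// subr_le0.
have := gK i (x j) t axj xjt tb; rewrite hE => /andP[gj1 gj2].
have xjb : x j <= b by exact: le_trans tb.
have /andP[ga _] := gK i a (x j) (lexx _) axj xjb.
have /andP[gb _] := gK i (x j) b axj xjb (lexx _).
split; first by rewrite -subr_ge0 ga -subr_ge0 gb.
rewrite distrC ger0_norm// (le_trans gj2)// (le_trans _ Kstep)//.
by rewrite ler_wpM2l.
Qed.

End step_networks.

(** * Networks with two opposite branches *)

Section two_branches.
Context {R : realType}.

Lemma oscillation_eq T (A : set T) (F : T -> R) (u v : T) : A u -> A v ->
  (forall z, A z -> F v <= F z <= F u) ->
  (ereal_sup [set (F z)%:E | z in A] - ereal_inf [set (F z)%:E | z in A])%E =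
  (F u - F v)%:E.
Proof.
move=> Au Av FA.
have -> : ereal_sup [set (F z)%:E | z in A] = (F u)%:E.
  apply/eqP; rewrite eq_le; apply/andP; split.
    by apply: ge_ereal_sup => _ [z Az <-]; rewrite lee_fin; have /andP[] := FA z Az.
  by apply: ereal_sup_ubound; exists u.
have -> : ereal_inf [set (F z)%:E | z in A] = (F v)%:E.
  apply/eqP; rewrite eq_le; apply/andP; split.
    by apply: ereal_inf_lbound; exists v.
  by apply: le_ereal_inf_tmp => _ [z Az <-]; rewrite lee_fin; have /andP[] := FA z Az.
by [].
Qed.

Variables (L N : nat) (fp fm : feedforward R L 1 N).
Hypotheses (fp0 : nneg_weights fp) (fm0 : nneg_weights fm).

Let two_branch (j : 'I_2) := if j == ord0 then fp else fm.
Let two_signs (j : 'I_2) : 'cV[R]_1 := const_mx (if j == ord0 then 1 else -1).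

Let two_branch_nneg j : nneg_weights (two_branch j).
Proof. by rewrite /two_branch; case: ifP. Qed.

Let two_signsP j i : two_signs j i ord0 = 1 \/ two_signs j i ord0 = - 1.
Proof. by rewrite mxE; case: ifP => _; [left|right]. Qed.

Definition two_branch_network : networkA R L 1 N :=
  NetworkA two_branch_nneg two_signsP.

Variables hp hm : 'I_N -> R -> R.
Hypothesis hpE : forall t i,
  feedforward_eval heaviside fp (const_mx t) i ord0 = hp i t.
Hypothesis hmE : forall t i,
  feedforward_eval heaviside fm (const_mx t) i ord0 = hm i t.

Let branch_evalE (j : 'I_2) t i :
  branch_eval heaviside (eta := two_branch_network) j (const_mx t) i ord0 =
  if j == ord0 then hp i t else hm i (- t).
Proof.
rewrite /branch_eval /= /two_branch /two_signs.
have -> (c : R) : map2_mx *%R (const_mx c) (const_mx t) =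
    const_mx (c * t) :> 'cV[R]_1.
  by apply/matrixP => k l; rewrite !mxE.
by case: ifP => _; rewrite ?hpE ?hmE ?mul1r ?mulN1r.
Qed.

Lemma two_branch_network_fun t i :
  network_fun heaviside two_branch_network t i ord0 = hp i t + hm i (- t).
Proof.
rewrite /network_fun /network_eval summxE big_ord_recl big_ord1.
by rewrite !branch_evalE.
Qed.

(** Each branch is monotone in t, so its supremum and its infimum are attained
    at the endpoints, which the sign of the second branch exchanges. *)
Lemma two_branch_EMVar (i : 'I_N) (a b : R) : a <= b ->
  {homo hp i : s t / s <= t} -> {homo hm i : s t / s <= t} ->
  EMVar_itv heaviside two_branch_network i a b =
  (hp i b - hp i a + (hm i (- a) - hm i (- b)))%:E.
Proof.
move=> ab hp_homo hm_homo.
have Iab t : `[a, b]%classic t ->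
    [set (const_mx t : 'cV[R]_1) | t in `[a, b]] (const_mx t).
  by exists t.
have Ia : `[a, b]%classic a by rewrite /= in_itv/= lexx.
have Ib : `[a, b]%classic b by rewrite /= in_itv/= lexx andbT.
rewrite /EMVar_itv /EMVar big_ord_recl big_ord1.
rewrite (@oscillation_eq _ _ _ (const_mx b) (const_mx a)); last 3 first.
- exact: Iab.
- exact: Iab.
- move=> _ [t + <-]; rewrite /= in_itv/= => /andP[at' tb].
  by rewrite !branch_evalE/= !hp_homo.
rewrite (@oscillation_eq _ _ _ (const_mx a) (const_mx b)); last 3 first.
- exact: Iab.
- exact: Iab.
- move=> _ [t + <-]; rewrite /= in_itv/= => /andP[at' tb].
  by rewrite !branch_evalE/= !hm_homo// lerN2.
by rewrite !branch_evalE.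
Qed.

End two_branches.

Section matrix_norm.
Context {R : realType}.

Lemma mx_norm_leP m n (x : 'M[R]_(m, n)) M : 0 <= M ->
  `|x| <= M <-> forall i j, `|x i j| <= M.
Proof.
move=> M0; rewrite {1}/Num.norm/= mx_normrE; split=> [xM i j|xM].
  apply: le_trans xM.
  exact: (le_bigmax _ (fun ij : 'I_m * 'I_n => `|x ij.1 ij.2|) (i, j)).
by apply: bigmax_le => // -[i j] _; exact: xM.
Qed.

End matrix_norm.

Section jordan_network.
Context {R : realType}.

(** Each of p and - q is approximated within e / 4: two such errors enter the
    value of the network, and four of them its estimated M-variation. *)
Lemma jordan_network L N (y : R -> 'cV[R]_N) (T K e : R) : (0 < L)%N ->
  0 < T -> 0 <= K -> 0 < e ->
  (forall i, lipschitz_itv K 0 T (fun t => y t i ord0)) ->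
  exists eta : networkA R L 1 N,
    [/\ forall t, 0 <= t <= T -> `|network_fun heaviside eta t - y t| <= e,
        forall i, (EMVar_itv heaviside eta i 0 T
          <= total_variation 0 T (fun t => y t i ord0))%E &
        forall i a b, 0 <= a -> a <= b -> b <= T ->
          (`|EMVar_itv heaviside eta i a b
             - total_variation a b (fun t => y t i ord0)| <= e%:E)%E].
Proof.
move=> L0 T0 K0 e0 lipy; have e40 : 0 < e / 4 by rewrite divr_gt0.
have /choice[p /choice[q pq]] :
    forall i, exists p q, _ := fun i => lipschitz_jordan (ltW T0) (lipy i).
have pK i : increments_le K 0 T (p i) by have [] := pq i.
have qK i : increments_le K (- T) 0 (fun t => - q i (- t)).
  move=> s t sT st t0; have [_ _ + _] := pq i.
  move=> /(_ (- t) (- s)); rewrite oppr_ge0 lerN2 lerNl => /(_ t0 st sT).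
  by move=> /andP[? ?]; apply/andP; lra.
have NT0 : - T < 0 by rewrite oppr_lt0.
have [fp fp0 [hp hpE [hp_homo hp_approx]]] := step_network_approx L0 T0 K0 e40 pK.
have [fm fm0 [hm hmE [hm_homo hm_approx]]] := step_network_approx L0 NT0 K0 e40 qK.
have hp_e i t : 0 <= t <= T -> `|hp i t - p i t| <= e / 4.
  by move=> /hp_approx -/(_ i)[].
have hm_e i t : 0 <= t <= T -> `|hm i (- t) + q i t| <= e / 4.
  move=> /andP[t0 tT]; have [|_] := hm_approx i (- t).
    by rewrite lerN2 tT oppr_le0.
  by rewrite !opprK.
exists (two_branch_network fp0 fm0); split.
- move=> t tT; apply/mx_norm_leP; first exact: ltW.
  move=> i j; rewrite ord1 mxE (two_branch_network_fun fp0 fm0 hpE hmE) mxE.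
  have := hp_e i t tT; have := hm_e i t tT; have [yE _ _ _] := pq i.
  rewrite -[y t i 0]/((fun t => y t i ord0) t) yE /=.
  rewrite !ler_norml => /andP[? ?] /andP[? ?]; apply/andP; lra.
- move=> i; rewrite (two_branch_EMVar fp0 fm0 hpE hmE (ltW T0))//.
  have [_ _ _ ->//] := pq i; last exact: ltW.
  have T00 : 0 <= T by exact: ltW.
  have [|/andP[_ ?] _] := hp_approx i T; first by rewrite T00 lexx.
  have [|/andP[? _] _] := hp_approx i 0; first by rewrite T00 lexx.
  have [|/andP[+ _] _] := hm_approx i (- T); first by rewrite oppr_le0 T00 lexx.
  have [|/andP[_ +] _] := hm_approx i 0; first by rewrite oppr_le0 T00 lexx.
  by rewrite !opprK !oppr0 lee_fin => ? ?; lra.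
- move=> i a b a0 ab bT; rewrite (two_branch_EMVar fp0 fm0 hpE hmE)//.
  have [_ _ _ ->//] := pq i; rewrite -EFinB lee_fin.
  have aT : 0 <= a <= T by rewrite a0 (le_trans ab).
  have bT' : 0 <= b <= T by rewrite bT (le_trans a0).
  have := hp_e i a aT; have := hm_e i a aT.
  have := hp_e i b bT'; have := hm_e i b bT'.
  rewrite !ler_norml => /andP[? ?] /andP[? ?] /andP[? ?] /andP[? ?].
  by apply/andP; lra.
Qed.

End jordan_network.

(** * Regularity of the solution *)

Section solution.
Context {R : realType}.
Local Notation mu := (@lebesgue_measure R).

Definition maps_bounded_sets N (T : R) (F : R * 'cV[R]_N -> 'cV[R]_N) :=
  forall A : set (R * 'cV[R]_N), A `<=` `[0, T] `*` setT ->
    bounded_set A -> bounded_set (F @` A).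

Lemma maps_bounded_sets_le N (T B : R) (F : R * 'cV[R]_N -> 'cV[R]_N) :
  maps_bounded_sets T F -> exists2 C, 0 <= C &
    forall t v, 0 <= t <= T -> `|v| <= B -> `|F (t, v)| <= C.
Proof.
move=> FT; pose A := [set z : R * 'cV[R]_N | 0 <= z.1 <= T /\ `|z.2| <= B].
have [||C [_ FC]] := FT A.
- by move=> [s v] [/= sT _]; split => //=; rewrite in_itv.
- exists (Num.max T B); split; first exact: num_real.
  move=> M TBM [s v] [/= /andP[s0 sT] vB].
  apply: le_trans (ltW TBM).
  by rewrite prod_normE /= ge_max !le_max (ger0_norm s0) sT vB orbT.
exists (`|C| + 1) => [|t v tT vB]; first by rewrite addr_ge0.
apply: FC; first by rewrite (le_lt_trans (ler_norm C))// ltrDl.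
by exists (t, v).
Qed.

Lemma Rintegral_itv_lipschitz (f : R -> R) (T K : R) : 0 <= K ->
  {ae mu, forall x, x \in `[0, T] -> `|f x| <= K} ->
  lipschitz_itv K 0 T (fun t => \int[mu]_(s in `[0, t]) f s).
Proof.
move=> K0 fK s t s0 st tT.
have st_le : (`[0, s] : set R) `<=` `[0, t].
  by move=> x; rewrite /= !in_itv/= => /andP[-> /le_trans]; apply.
have -> : t - s = fine (mu (`[0, t] `\` `[0, s])).
  have -> : (`[0, t] `\` `[0, s])%classic = `]s, t]%classic :> set R.
    apply/seteqP; split => [x|x]; rewrite /= !in_itv/=.
      by move=> [/andP[-> ->] /negP]; rewrite -ltNge andbT.
    move=> /andP[sx ->]; rewrite (le_trans s0 (ltW sx)); split=> //.
    by apply/negP; rewrite -ltNge.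
  rewrite lebesgue_measure_itv/= lte_fin; case: ltP => //= ts.
  by apply/eqP; rewrite subr_eq0 eq_le st ts.
apply: (Rintegral_setD_le (T := measurableTypeR R)) => //.
  by rewrite /= lebesgue_measure_itv/=; case: ifP; rewrite ?ltry.
apply: (@filterS _ _ (ae_filter_ringOfSetsType mu)) fK => x fxK xt; apply: fxK.
by move: xt; rewrite /= !in_itv/= => /andP[-> /le_trans]; apply.
Qed.

Lemma ae_neq (c : R) : {ae mu, forall x, x != c}.
Proof.
exists [set c]; split; first exact: measurable_set1.
  exact: lebesgue_measure_set1.
by move=> x /= /negP; rewrite negbK => /eqP.
Qed.

(** By [sobolev11_ae_bounded] the values y(s) lie, for almost every s, in a
    fixed ball; there F is bounded by some K, and so are the increments of the
    indefinite integral relative to the length of the interval. *)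
Lemma solution_lipschitz N (T : R) (y : R -> 'cV[R]_N)
    (F : R * 'cV[R]_N -> 'cV[R]_N) (y0 : 'cV[R]_N) : 0 < T ->
  sobolev11_vec 0 T y -> maps_bounded_sets T F ->
  (forall t, 0 <= t <= T -> forall i, y t i ord0 =
     \int[mu]_(s in `[0, t]) (F (s, y s) i ord0) + y0 i ord0) ->
  exists2 K, 0 <= K & forall i, lipschitz_itv K 0 T (fun t => y t i ord0).
Proof.
move=> T0 sy FT yF.
have /choice[M yM] := fun i => sobolev11_ae_bounded T0 (sy i).
pose B := \sum_i `|M i|.
have B0 : 0 <= B by exact: sumr_ge0.
have [K K0 FK] := maps_bounded_sets_le B FT.
exists K => // i s t s0 st tT.
rewrite !yF ?s0 ?tT ?(le_trans st tT) ?(le_trans s0 st)//.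
rewrite opprD addrACA subrr addr0.
apply: (@Rintegral_itv_lipschitz (fun s => F (s, y s) i ord0) T) => //.
have aeF := ae_filter_ringOfSetsType mu.
have yM_all := @filter_forall _ _ _ _ aeF yM.
apply: (@filterS3 _ _ aeF) yM_all (ae_neq 0) (ae_neq T) => x yxM x0 xT.
rewrite in_itv/= => /andP[lex0 lexT].
have : `|F (x, y x)| <= K.
  apply: FK; first by rewrite lex0.
  apply/mx_norm_leP => // k l; rewrite ord1.
  apply: le_trans (yxM k _) _.
    by rewrite in_itv/= !lt_neqAle eq_sym x0 lex0 xT.
  apply: le_trans (ler_norm _) _.
  by rewrite /B (bigD1 k)//= lerDl sumr_ge0.
by move=> /(mx_norm_leP _ K0); apply.
Qed.

Lemma ess_sup_itv_le (a b e : R) (f : R -> R) :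
  (forall t, a <= t <= b -> f t <= e) -> (ess_sup_itv a b f <= e%:E)%E.
Proof.
move=> fe; apply: ereal_inf_lbound; exists (~` `[a, b]); split.
- exact: measurableC.
- by rewrite /= /mrestr /= setICl measure0.
move=> x /=; apply: contra_not; rewrite in_itv/= => xab.
by rewrite lee_fin fe.
Qed.

End solution.

Unset Implicit Arguments.

Theorem theoremC3 (R : realType) :
  exists2 sigma : R -> R, {homo sigma : u v / u <= v} &
  forall (L : nat) (hL : (0 < L)%N) (N : nat) (T : R) (hT : 0 < T)
    (y : R -> 'cV[R]_N) (hy : sobolev11_vec 0 T y)
    (F : R * 'cV[R]_N -> 'cV[R]_N)
    (hFmeas : borel_measurable_fun
       (`[0, T] `*` [set: 'cV[R]_N] : set (R * 'cV[R]_N)%type) F)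
    (hFbnd : forall A : set (R * 'cV[R]_N), A `<=` `[0, T] `*` setT ->
       bounded_set A -> bounded_set (F @` A))
    (y0 : 'cV[R]_N)
    (hyF : forall t : R, 0 <= t <= T -> forall i : 'I_N,
       y t i ord0 =
       (\int[@lebesgue_measure R]_(s in `[0, t]) (F (s, y s) i ord0))
         + y0 i ord0),
  exists C : R, forall eps : R, 0 < eps ->
  exists eta : networkA R L 1 N,
    [/\ (ess_sup_itv 0 T (fun t => `|network_fun sigma eta t - y t|)%R
           <= eps%:E)%E,
        forall i : 'I_N,
          (EMVar_itv sigma eta i 0 T
             <= total_variation 0 T (fun t => y t i ord0))%E,
        forall (i : 'I_N) (a b : R),
          0 <= a -> a <= b -> b <= T ->
          (`|EMVar_itv sigma eta i a b
             - total_variation a b (fun t => y t i ord0)| <= eps%:E)%E &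
        (ereal_sup [set `|F (t, network_fun sigma eta t)|%:E | t in `[0%R, T]]
           <= C%:E)%E].
Proof.
exists heaviside; first exact: heaviside_homo.
move=> L hL N T hT y hy F _ hFbnd y0 hyF.
have [K K0 ylip] := solution_lipschitz hT hy hFbnd hyF.
pose B := `|y 0| + K * T.
have B0 : 0 <= B by rewrite addr_ge0// mulr_ge0// ltW.
have yB t : 0 <= t <= T -> `|y t| <= B.
  move=> /andP[t0 tT]; rewrite -(subrK (y 0) (y t)) addrC.
  apply: le_trans (ler_normD _ _) _; rewrite lerD2l.
  apply/mx_norm_leP; first by rewrite mulr_ge0// ltW.
  move=> i j; rewrite ord1 !mxE; apply: le_trans (ylip i 0 t (lexx _) t0 tT) _.
  by rewrite subr0 ler_wpM2l.
have [C _ FC] := maps_bounded_sets_le (B + 1) hFbnd.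
exists C => eps eps0; pose e := Num.min eps 1.
have e0 : 0 < e by rewrite lt_min eps0 ltr01.
have [e_eps e1] : e <= eps /\ e <= 1 by rewrite !ge_min !lexx orbT.
have [eta [eta_y eta_T eta_ab]] := jordan_network hL hT K0 e0 ylip.
exists eta; split => //.
- by apply: ess_sup_itv_le => t tT; apply: le_trans (eta_y t tT) _.
- by move=> i a b a0 ab bT; apply: le_trans (eta_ab i a b a0 ab bT) _; rewrite lee_fin.
apply: ge_ereal_sup => _ [t + <-]; rewrite /= in_itv/= => tT.
rewrite lee_fin; apply: FC => //.
rewrite -(subrK (y t) (network_fun _ _ _)) addrC.
apply: le_trans (ler_normD _ _) _; apply: lerD; first exact: yB.
exact: le_trans (eta_y t tT) _.
Qed.
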